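(* Let $G$ be a finite simple graph with vertex set $\{u_1,\dots,u_n\}$ and $m_G$ edges, and let $r$ be a restraint on $G$. Write, for all integers $x\geq M_{G,r}$, $$\pi_r(G,x)=\sum_{i=0}^n (-1)^{n-i}a_i(G,r)x^i .$$ Then $$a_{n-2}(G,r)={m_G\choose 2}-\eta_G(C_3)+\sum_{i<j}|r(u_i)|\,|r(u_j)|+m_G\sum_{i=1}^n|r(u_i)|-\sum_{u_iu_j\in E(G)}|r(u_i)\cap r(u_j)|,$$ where $\eta_G(C_3)$ is the number of triangles (subgraphs isomorphic to $C_3$) in $G$ and the last sum runs over the edges of $G$ (each edge counted once).
   Context: A restraint $r$ on a graph $G$ is a function assigning to each vertex $v$ a finite set $r(v)\subset\mathbb{N}$ of forbidden colours. A proper $x$-colouring $c:V(G)\to\{1,\dots,x\}$ is permitted by $r$ if $c(v)\notin r(v)$ for every vertex $v$. The restrained chromatic polynomial $\pi_r(G,x)$ is the number of proper $x$-colourings of $G$ permitted by $r$. $M_{G,r}$ denotes the maximum element of $\bigcup_{v}r(v)$ if this set is nonempty, and $0$ otherwise. For $x\geq M_{G,r}$, $\pi_r(G,x)$ agrees with a monic polynomial of degree $n$ in $x$ with integer coefficients; the $a_i(G,r)$ are defined via this polynomial. *)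

(* Defs.v *)
From mathcomp Require Import all_boot.
From mathcomp Require Export finmap.

Set Implicit Arguments.
Unset Strict Implicit.
Unset Printing Implicit Defensive.

Local Open Scope fset_scope.

Record sgraph (V : finType) := SGraph {
  edges : {set {set V}};
  edges_card2 : forall e, e \in edges -> #|e| = 2
}.

Definition adj (V : finType) (G : sgraph V) (x y : V) : bool :=
  [set x; y] \in edges G.

(* Colours are positive integers, so 0 is never a forbidden colour. *)
Record restraint (V : finType) := Restraint {
  forbidden :> V -> {fset nat};
  forbidden_pos : forall v, 0 \notin forbidden v
}.

Definition max_forbidden (V : finType) (r : restraint V) : nat :=
  \max_(v : V) \max_(k <- r v) k.

(* The palette {1, ..., x} is indexed by 'I_x: k : 'I_x is the colour k.+1. *)
Definition permitted_colourings (V : finType) (G : sgraph V) (r : restraint V)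
    (x : nat) : {set {ffun V -> 'I_x}} :=
  [set c : {ffun V -> 'I_x} | [forall u, forall v, adj G u v ==> (c u != c v)] &
           [forall v, (c v).+1 \notin r v]].

Definition restrained_count (V : finType) (G : sgraph V) (r : restraint V)
    (x : nat) : nat :=
  #|permitted_colourings G r x|.

(* A subgraph is a pair (vertex set, edge set); it is isomorphic to C_3 when it
   is the image of the cycle on 'I_3 under an injection h. *)
Definition triangles (V : finType) (G : sgraph V) :
    {set {set V} * {set {set V}}} :=
  [set H : {set V} * {set {set V}} | (H.2 \subset edges G) &
     [exists h : {ffun 'I_3 -> V},
        [&& injectiveb h,
            H.1 == [set h i | i : 'I_3] &
            H.2 == [set [set h i; h (ordS i)] | i : 'I_3]]]].

(* Main.v *)
(** Whitney's inclusion-exclusion over edge sets writes the count as the sum over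
    S of (-1)^|S| N_S(x), where N_S counts the permitted colourings that are
    constant along every edge of S.  Choosing one representative in each
    component of S, N_S(x) is the product over the representatives v of
    x - |union of r over the component of v|.  Its degree is n minus the number
    of vertices that are not representatives, so only the empty set, single
    edges, pairs of edges and triangles reach x^(n-2): they contribute
    respectively the sum of the |r(u_i)||r(u_j)|, the terms
    sum |r| - |r(a) n r(b)| for each edge ab, 1 for each pair and -1 for each
    triangle. *)

Require Import Defs.
From mathcomp Require Import all_boot all_order all_algebra finmap.

Set Implicit Arguments.
Unset Strict Implicit.
Unset Printing Implicit Defensive.

Import GRing.Theory Num.Theory.
Local Open Scope fset_scope.
Local Open Scope ring_scope.

(** * Integer polynomials: equality from large arguments, top coefficients of products of linear
    factors *)

Lemma poly_int_eventually_inj (p q : {poly int}) (M : nat) :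
  (forall x : nat, (M <= x)%N -> p.[x%:Z] = q.[x%:Z]) -> p = q.
Proof.
move=> pq; apply/eqP; rewrite -subr_eq0; apply: contraT => pq0.
(* These are [size (p - q)] distinct roots, one more than the degree allows. *)
pose rs := [seq (M + k)%N%:Z | k <- iota 0 (size (p - q))].
suff: (size rs < size (p - q)%R)%N by rewrite size_map size_iota ltnn.
apply: max_poly_roots => //.
  apply/allP => _ /mapP[k _ ->].
  by rewrite rootE hornerD hornerN pq ?subrr ?leq_addr.
by rewrite map_inj_uniq ?iota_uniq // => k l [] /addnI.
Qed.

Lemma size_prod_XsubC_in (R : comNzRingType) (I : finType) (A : {pred I})
    (F : I -> R) :
  size (\prod_(i in A) ('X - (F i)%:P)) = #|A|.+1.
Proof. by rewrite -big_enum size_prod_XsubC -cardE. Qed.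

Lemma coefPn_prod_XsubC_in (R : comNzRingType) (I : finType) (A : {pred I})
    (F : I -> R) :
  (0 < #|A|)%N ->
  (\prod_(i in A) ('X - (F i)%:P))`_(#|A|.-1) = - \sum_(i in A) F i.
Proof.
move=> A0; have := @coefPn_prod_XsubC R [seq F i | i in A].
rewrite size_image -lt0n => /(_ A0).
by rewrite !big_image /=.
Qed.

(** The second elementary symmetric function: when the last factor is split off, the pairs
    containing the last index come from the subleading coefficient of the remaining product. *)
Lemma coefPnn_prod_XsubC (R : comNzRingType) (n : nat) (F : nat -> R) :
  (\prod_(i < n.+2) ('X - (F i)%:P))`_n =
  \sum_(j < n.+2) \sum_(i < j) F i * F j.
Proof.
elim: n => [|n IHn].
  rewrite !big_ord_recr !big_ord0 /= !mul1r.
  by rewrite !add0r coef0M !coefB !coefX !coefC /= !sub0r mulrNN.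
rewrite big_ord_recr [RHS]big_ord_recr /= mulrBr coefB coefMX coefMC /= IHn.
congr (_ + _); have := @coefPn_prod_XsubC_in R 'I_n.+2 predT F.
by rewrite card_ord => -> //; rewrite mulNr opprK mulr_suml.
Qed.

(** * Retractions onto representatives of the components of an edge set *)

Definition constant_on (V : finType) (T : eqType) (c : V -> T) (e : {set V}) :=
  [forall a in e, forall b in e, c a == c b].

Lemma constant_on2 (V : finType) (T : eqType) (c : V -> T) (a b : V) :
  constant_on c [set a; b] = (c a == c b).
Proof.
apply/forall_inP/eqP => [h|cab x].
  by have /forall_inP/(_ b) := h a (set21 a b); rewrite set22 => /(_ isT)/eqP.
by move=> /set2P[]->; apply/forall_inP => y /set2P[]->; rewrite ?cab.
Qed.

(* f sends each vertex to a representative of its component in (V, S); quantifying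
   over all colourings c replaces any mention of paths. *)
Definition retraction (V : finType) (S : {set {set V}}) (f : V -> V) : Prop :=
  (forall v, f (f v) = f v) /\
  forall (T : eqType) (c : V -> T),
    [forall e in S, constant_on c e] = [forall v, c (f v) == c v].

Definition moved (V : finType) (f : V -> V) : {set V} := [set v | f v != v].

Section Retractions.
Variable V : finType.
Implicit Types (S : {set {set V}}) (f : V -> V).

(* Adding the edge ab to S redirects the class of a to the class of b, which
   moves at most one further vertex, namely the old representative of a. *)
Lemma exists_retraction S : {in S, forall e : {set V}, #|e| = 2%N} ->
  exists f, retraction S f /\ (#|moved f| <= #|S|)%N.
Proof.
elim: {S}_.+1 {-2}S (ltnSn #|S|) => // k IHk S; rewrite ltnS => leSk S2.
have [->|[e eS]] := set_0Vmem S.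
  exists id; split; last first.
    by rewrite cards0 leqn0 cards_eq0; apply/eqP/setP=> v; rewrite !inE eqxx.
  split=> // T c; apply/idP/idP => _; apply/forallP => x; first exact: eqxx.
  by rewrite inE.
have lt_Sk : (#|S :\ e| < k)%N by rewrite (cardsD1 e) eS in leSk.
have [|f' [[f'K f'P] le_f']] := IHk _ lt_Sk.
  by move=> e' /setD1P[_]; apply: S2.
have /eqP/cards2P[a [b [_ eab]]] := S2 e eS.
pose f w := if f' w == f' a then f' b else f' w.
have ff' w : f (f' w) = f w by rewrite /f f'K.
have fK w : f (f w) = f w.
  rewrite {2 3}/f; case: ifP => [_|ne]; rewrite /f f'K ?ne //.
  by case: ifP.
exists f; split; last first.
  have sub : moved f \subset f' a |: moved f'.
    apply/subsetP => w; rewrite !inE /f.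
    case: (f' w =P f' a) => [<- _|_ ->]; last by rewrite orbT.
    by rewrite eq_sym orbN.
  apply: leq_trans (subset_leq_card sub) _.
  rewrite cardsU1 (cardsD1 e S) eS; exact: leq_add (leq_b1 _) le_f'.
split=> // T c; apply/forall_inP/forallP => [cS w|cf].
  have /eqP cab : c a == c b by rewrite -constant_on2 -eab cS.
  have /forallP cf' : [forall v, c (f' v) == c v].
    by rewrite -f'P; apply/forall_inP => e' /setD1P[_]; apply: cS.
  rewrite /f; case: (f' w =P f' a) => // fwa.
  by rewrite (eqP (cf' b)) -cab -(eqP (cf' a)) -fwa.
(* As [f] agrees at [v] and [f' v], invariance of [c] under [f] gives invariance under [f']. *)
have cf' v : c (f' v) == c v by rewrite -(eqP (cf v)) -ff' (eqP (cf _)).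
move=> e' e'S; have [->|ne] := eqVneq e' e.
  rewrite eab constant_on2 -(eqP (cf a)) /f eqxx; exact: cf'.
have /forall_inP : [forall e0 in S :\ e, constant_on c e0].
  by rewrite f'P; apply/forallP.
by apply; rewrite !inE ne.
Qed.

(** Idempotence makes [f], viewed as a colouring, invariant under itself, hence constant along every
    edge of [S]. *)
Lemma retraction_edge S f a b : retraction S f -> [set a; b] \in S -> f a = f b.
Proof.
move=> [fK fP] abS; apply/eqP; rewrite -constant_on2.
have /forall_inP : [forall e in S, constant_on f e].
  by rewrite fP; apply/forallP => v; rewrite fK.
exact.
Qed.

(* An edge of S joins two vertices with the same representative, so either one
   end is the representative of the other, or both ends are moved. *)
Lemma retraction_edges S f :
  {in S, forall e : {set V}, #|e| = 2%N} -> retraction S f ->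
  S \subset [set [set p; f p] | p in moved f]
        :|: [set A : {set V} | A \subset moved f & #|A| == 2].
Proof.
move=> S2 rf; apply/subsetP => e eS.
have e2 := S2 e eS; have /eqP/cards2P[a [b [ab eab]]] := e2.
have fab : f a = f b by apply: retraction_edge rf _; rewrite -eab.
rewrite inE; have [fa|fa] := eqVneq (f a) a.
  apply/orP; left; apply/imsetP; exists b; last by rewrite -fab fa eab setUC.
  by rewrite inE -fab fa.
have [fb|fb] := eqVneq (f b) b.
  by apply/orP; left; apply/imsetP; exists a; rewrite ?inE // eab fab fb.
by apply/orP; right; rewrite inE e2 eqxx andbT eab subUset !sub1set !inE fa fb.
Qed.

(** Serves as a lower bound on the moved vertices: two or more edges force at least two of them. *)
Lemma card_retraction_edges S f :
  {in S, forall e : {set V}, #|e| = 2%N} -> retraction S f ->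
  (#|S| <= #|moved f| + 'C(#|moved f|, 2))%N.
Proof.
move=> S2 rf; apply: leq_trans (subset_leq_card (retraction_edges S2 rf)) _.
by rewrite -cards_draws (leq_trans (leq_card_setU _ _)) // leq_add2r leq_imset_card.
Qed.

End Retractions.

(** * Counting colourings constant along an edge set, and Whitney's expansion *)

Lemma card_avoiding (x : nat) (A : {fset nat}) :
  (forall k, k \in A -> (0 < k <= x)%N) ->
  #|[pred k : 'I_x | k.+1 \notin A]|%:Z = x%:Z - #|` A|%:Z.
Proof.
move=> hA.
have cA : #|[pred k : 'I_x | k.+1 \in A]| = #|` A|.
  rewrite cardE -(size_map (fun k : 'I_x => k.+1)); apply: perm_size.
  apply: uniq_perm; rewrite ?fset_uniq //.
    by rewrite map_inj_uniq ?enum_uniq // => k l [/val_inj].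
  move=> k; apply/mapP/idP => [[l + ->]|kA]; first by rewrite mem_enum.
  have /andP[k0 kx] := hA k kA.
  have lt_k : (k.-1 < x)%N by rewrite prednK.
  by exists (Ordinal lt_k); rewrite ?mem_enum ?inE /= prednK.
have Ex : (#|[pred k : 'I_x | k.+1 \in A]| +
           #|[predC [pred k : 'I_x | k.+1 \in A]]|)%N = x by rewrite cardC card_ord.
by rewrite -[X in _ = X%:Z - _]Ex cA PoszD addrC addKr; congr Posz; apply: eq_card.
Qed.

Lemma forbidden_bounds (V : finType) (r : restraint V) v k :
  k \in r v -> (0 < k <= max_forbidden r)%N.
Proof.
move=> krv; apply/andP; split.
  by rewrite lt0n; apply: contraTneq krv => ->; apply: forbidden_pos.
apply: leq_trans (leq_bigmax_cond (P := predT) v isT).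
exact: (leq_bigmax_seq (F := id)).
Qed.

Section Counting.
Variables (V : finType) (r : restraint V).
Implicit Types (S : {set {set V}}) (f : V -> V).

Definition fibre_forbidden f (v : V) : {fset nat} :=
  \bigcup_(w | f w == v) r w.

Definition retraction_poly f : {poly int} :=
  \prod_(v in ~: moved f) ('X - (#|` fibre_forbidden f v|)%:Z%:P).

Definition constant_colourings S x : {set {ffun V -> 'I_x}} :=
  [set c : {ffun V -> 'I_x} | [forall e in S, constant_on c e] &
                              [forall v, (c v).+1 \notin r v]].

(** Such a colouring is determined by its values at the fixed vertices of [f]. These are chosen
    independently, each outside the colours forbidden anywhere in its fibre. *)
Lemma card_constant_colourings S f x : retraction S f ->
  (max_forbidden r < x)%N ->
  #|constant_colourings S x|%:Z = (retraction_poly f).[x%:Z].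
Proof.
(* The strict bound makes the palette nonempty, so [ord0] can serve as the default value at moved
   vertices. *)
move=> [fK fP]; case: x => // x; rewrite ltnS => le_x.
pose F v := [pred k : 'I_x.+1 | k.+1 \notin fibre_forbidden f v].
pose g (h : {ffun V -> 'I_x.+1}) := [ffun v => h (f v)].
have fixP v : (v \in ~: moved f) = (f v == v) by rewrite !inE negbK.
have -> : constant_colourings S x.+1
        = g @: [set h in pfamily ord0 (mem (~: moved f)) F].
  apply/setP => c; rewrite inE fP; apply/andP/imsetP.
    move=> [/forallP cf /forallP cr].
    exists [ffun v => if f v == v then c v else ord0]; last first.
      by apply/ffunP => v; rewrite !ffunE fK eqxx (eqP (cf v)).
    rewrite inE; apply/pfamilyP; split.
      by apply/subsetP => v; rewrite !inE ffunE; case: (f v == v); rewrite ?eqxx.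
    move=> v; rewrite [v \in _]fixP => fv; rewrite !inE ffunE fv.
    apply/bigfcupP => -[w /andP[_ /eqP fw]].
    by rewrite -fw (eqP (cf w)); apply/negP.
  move=> [h]; rewrite inE => /pfamilyP[_ hF] ->; split; apply/forallP => v.
    by rewrite !ffunE fK.
  have fv : f v \in mem (~: moved f) by rewrite [_ \in _]fixP fK.
  have := hF _ fv; rewrite ffunE !inE; apply: contra => hr.
  by apply/bigfcupP; exists v; rewrite ?mem_index_enum /=.
(* Injectivity: [h] is read off from [g h] at fixed vertices and equals [ord0] at moved ones. *)
rewrite card_in_imset => [|h1 h2]; last first.
  rewrite !inE => /pfamilyP[s1 _] /pfamilyP[s2 _] eg; apply/ffunP => v.
  have [fv|fv] := boolP (v \in ~: moved f).
    by have /ffunP/(_ v) := eg; rewrite !ffunE; move: fv; rewrite fixP => /eqP->.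
  have out (h : {ffun V -> 'I_x.+1}) :
      ord0.-support h \subset mem (~: moved f) -> h v = ord0.
    by move=> /subsetP/(_ v)/contra/(_ fv); rewrite inE negbK => /eqP.
  by rewrite !out.
rewrite cardsE card_pfamily foldrE big_image /= /retraction_poly horner_prod.
rewrite (big_morph Posz PoszM (erefl _)); apply: eq_bigr => v _.
rewrite hornerXsubC; apply: card_avoiding => k /bigfcupP[w _ /forbidden_bounds].
by case/andP=> -> le_k /=; rewrite (leq_trans le_k) // ltnW.
Qed.

(** Both polynomials count the same colourings for all large [x]. An explicit retraction may thus
    replace an arbitrary one. *)
Lemma retraction_poly_unique S f g :
  retraction S f -> retraction S g -> retraction_poly f = retraction_poly g.
Proof.
move=> rf rg; apply: (@poly_int_eventually_inj _ _ (max_forbidden r).+1) => x le_x.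
by rewrite -!(@card_constant_colourings S).
Qed.

Lemma permitted_colourings_edges (G : sgraph V) x :
  permitted_colourings G r x =
  [set c : {ffun V -> 'I_x} | [forall e in edges G, ~~ constant_on c e] &
                              [forall v, (c v).+1 \notin r v]].
Proof.
apply/setP => c; rewrite !inE; congr (_ && _).
apply/forallP/forall_inP => [h e eG|h a]; last first.
  by apply/forallP => b; apply/implyP => /h; rewrite constant_on2.
have /eqP/cards2P[a [b [_ eab]]] := edges_card2 eG.
rewrite eab constant_on2; have /forallP/(_ b)/implyP := h a; apply.
by rewrite /adj -eab.
Qed.

Lemma restrained_count_expansion (G : sgraph V) x :
  (restrained_count G r x)%:Z =
  \sum_(S : {set {set V}} | S \subset edges G)
     (-1) ^+ #|S| * #|constant_colourings S x|%:Z.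
Proof.
have cardE' (P : pred {ffun V -> 'I_x}) (p : pred {ffun V -> 'I_x}) :
    #|[set c | P c & p c]|%:Z = \sum_(c | p c) (P c)%:Z.
  rewrite -sum1_card (big_morph Posz PoszD (erefl _)) [RHS]big_mkcond.
  rewrite [LHS]big_mkcond /=; apply: eq_bigr => c _; rewrite inE.
  by case: (P c); case: (p c).
rewrite /restrained_count permitted_colourings_edges cardE'.
under [RHS]eq_bigr do rewrite cardE' mulr_sumr.
rewrite exchange_big /=; apply: eq_bigr => c _.
(* As [b] vanishes off the edges, the product over all vertex sets is the indicator of properness,
   and only sets of edges survive in its expansion. *)
pose b e := (e \in edges G) && constant_on c e.
transitivity (\prod_(e : {set V}) (- (b e)%:Z + 1)).
  have [/forall_inP h|] := boolP [forall e in edges G, ~~ constant_on c e].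
    rewrite big1 // => e _; rewrite /b; case: (boolP (e \in _)) => // /h/negPf->.
    by rewrite oppr0 add0r.
  rewrite negb_forall_in => /exists_inP[e eG]; rewrite negbK => ce.
  by rewrite (bigD1 e) //= /b eG ce addNr mul0r.
rewrite bigA_distr [RHS]big_mkcond /=; apply: eq_bigr => S _.
rewrite -big_mkcond /= prodrN.
have -> : \prod_(e in S) (b e)%:Z = [forall e in S, b e]%:Z.
  have [/forall_inP h|] := boolP [forall e in S, b e].
    by rewrite big1 // => e /h->.
  rewrite negb_forall_in => /exists_inP[e eS /negPf be].
  by rewrite (bigD1 e) //= be mul0r.
have [/subsetP sSG|] := boolP (S \subset edges G).
  congr (_ * (nat_of_bool _)%:Z).
  by apply/forall_inP/forall_inP => h e eS; have := h e eS; rewrite /b sSG.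
move/subsetPn => [e eS /negPf eG].
suff -> : [forall e in S, b e] = false by rewrite mulr0.
by apply/forall_inP => /(_ e eS); rewrite /b eG.
Qed.

End Counting.

(** * Triangles as sets of three edges *)

Definition triangle_edges (V : finType) (a b d : V) : {set {set V}} :=
  [set [set a; b]; [set b; d]; [set d; a]].

Section Triangles.
Variables (V : finType) (G : sgraph V).

(** Trades the embedded cycle for three named vertices, the values of [h] at 0, 1 and 2; this form
    can be matched against an edge set. *)
Lemma mem_triangles (S : {set {set V}}) :
  (S \in snd @: triangles G) <->
  S \subset edges G /\ exists a b d,
    [/\ a != b, b != d, d != a & S = triangle_edges a b d].
Proof.
have cycle3 (h : 'I_3 -> V) : [set [set h i; h (ordS i)] | i : 'I_3] =
    triangle_edges (h (inord 0)) (h (inord 1)) (h (inord 2)).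
  have o k (i : 'I_3) : nat_of_ord i = k -> i = inord k by move<-; rewrite inord_val.
  apply/setP => e; rewrite !inE; apply/imsetP/idP.
    move=> [[[|[|[|i]]] //= lt_i] _ ->].
    - by rewrite (o 0 (Ordinal lt_i)) // (o 1 (ordS _)) ?eqxx //= inordK.
    - by rewrite (o 1 (Ordinal lt_i)) // (o 2 (ordS _)) ?eqxx ?orbT //= inordK.
    - by rewrite (o 2 (Ordinal lt_i)) // (o 0 (ordS _)) ?eqxx ?orbT //= inordK.
  move=> /orP[/orP[]|] /eqP->.
  - by exists (inord 0) => //; rewrite (o 1 (ordS _)) //= inordK.
  - by exists (inord 1) => //; rewrite (o 2 (ordS _)) //= inordK.
  - by exists (inord 2) => //; rewrite (o 0 (ordS _)) //= inordK.
split=> [/imsetP[H]|[sSG [a [b [d [ab bd da ES]]]]]].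
  rewrite inE => /andP[sHG /existsP[h /and3P[/injectiveP hI _ /eqP EH]]] ->.
  split=> //; exists (h (inord 0)), (h (inord 1)), (h (inord 2)).
  by rewrite EH cycle3; split=> //; rewrite (inj_eq hI) -val_eqE /= !inordK.
pose h := [ffun i : 'I_3 => nth a [:: a; b; d] i].
apply/imsetP; exists ([set h i | i : 'I_3], S) => //; rewrite inE /= sSG.
apply/existsP; exists h; rewrite eqxx /= cycle3 !ffunE !inordK //= ES eqxx andbT.
apply/injectiveP => i j; rewrite !ffunE => /eqP.
rewrite nth_uniq //= ?inE ?negb_or ?ab ?bd ?(eq_sym a d) ?da //.
by move/eqP/val_inj.
Qed.

(** The vertex set of a triangle is the union of its edges, so the edge set alone determines the
    triangle. *)
Lemma card_triangles : #|triangles G| = #|snd @: triangles G|.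
Proof.
rewrite card_in_imset // => -[A S] [B T]; rewrite !inE /=.
have coverE (C : {set V}) (U : {set {set V}}) (h : {ffun 'I_3 -> V}) :
    C = [set h i | i : 'I_3] -> U = [set [set h i; h (ordS i)] | i : 'I_3] ->
    C = cover U.
  move=> -> ->; apply/setP => v; apply/imsetP/bigcupP => [[i _ ->]|[e]].
    by exists [set h i; h (ordS i)]; rewrite ?set21 //; apply/imsetP; exists i.
  by move=> /imsetP[i _ ->] /set2P[]->; [exists i|exists (ordS i)].
move=> /andP[_ /existsP[h /and3P[_ /eqP EA /eqP ES]]].
move=> /andP[_ /existsP[g /and3P[_ /eqP EB /eqP ET]]] EST.
by rewrite (coverE _ _ _ EA ES) (coverE _ _ _ EB ET) EST.
Qed.

Lemma card_triangle_edges (a b d : V) :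
  a != b -> b != d -> d != a -> #|triangle_edges a b d| = 3.
Proof.
move=> ab bd da.
have neq (x y z : V) : x != z -> y != z -> x != y -> [set x; y] != [set y; z].
  move=> xz yz xy; apply/eqP => /setP/(_ x).
  by rewrite !inE eqxx (negPf xz) (negPf xy).
rewrite /triangle_edges setUC cardsU1 cards2 !inE.
by rewrite (eq_sym _ [set b; d]) !(negPf (neq _ _ _ _ _ _)) // eq_sym.
Qed.

End Triangles.

(** * The coefficient of index [n] of [retraction_poly] on [n.+2] vertices *)

Section Coefficients.
Variables (V : finType) (r : restraint V) (n : nat).
Hypothesis cardV : #|V| = n.+2.
Implicit Types (S : {set {set V}}) (f : V -> V).

Lemma card_fixed f : (#|moved f| + #|~: moved f|)%N = n.+2.
Proof. by rewrite cardsC. Qed.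

(** Exactly [n] factors remain, so this is the leading coefficient of a monic product. *)
Lemma coef_retraction_poly_moved2 f : #|moved f| = 2%N ->
  (retraction_poly r f)`_n = 1.
Proof.
move=> f2; have := card_fixed f; rewrite f2 !addSn add0n => -[cf].
have /monicP := monic_prod_XsubC (index_enum V) (mem (~: moved f))
  (fun v => (#|` fibre_forbidden r f v|)%:Z).
by rewrite /lead_coef size_prod_XsubC_in /= cf.
Qed.

Lemma coef_retraction_poly_moved3 f : (2 < #|moved f|)%N ->
  (retraction_poly r f)`_n = 0.
Proof.
move=> f3; apply: nth_default; rewrite size_prod_XsubC_in.
have := card_fixed f; case: #|moved f| f3 => [|[|[|k]]] // _.
by rewrite !addSn => -[<-]; rewrite ltnS leq_addl.
Qed.

Lemma coef_retraction_poly0 f (u : 'I_n.+2 -> V) : bijective u ->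
  retraction set0 f ->
  (retraction_poly r f)`_n =
  \sum_(i < n.+2) \sum_(j < n.+2 | (i < j)%N)
    (#|` r (u i)|)%:Z * (#|` r (u j)|)%:Z.
Proof.
(* Testing against the identity colouring, which is vacuously constant along no edges, forces [f] to
   be the identity. *)
move=> bij_u [_ /(_ V id)].
have -> : [forall e in set0 : {set {set V}}, constant_on id e].
  by apply/forall_inP => e; rewrite inE.
move=> /esym/forallP/= fE.
have -> : retraction_poly r f = \prod_v ('X - (#|` r v|)%:Z%:P).
  rewrite /retraction_poly; apply: eq_big => [v|v _]; first by rewrite !inE fE.
  rewrite /fibre_forbidden (big_pred1 v) // => w /=.
  by rewrite (eqP (fE w)).
(* The formula for the second symmetric function takes a family indexed by [nat], hence the detour
   through [inord]. *)
pose F k := (#|` r (u (inord k))|)%:Z.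
rewrite (reindex u) /=; last exact: onW_bij.
under eq_bigr => i _ do rewrite -[i in r (u i)]inord_val -/(F i).
rewrite coefPnn_prod_XsubC [RHS](exchange_big_dep xpredT) //=.
apply: eq_bigr => j _; rewrite (big_ord_widen n.+2 (fun k => F k * F j) (ltnW (ltn_ord j))).
by apply: eq_bigr => i _; rewrite /F !inord_val.
Qed.

(** By uniqueness [f] may be taken to send [a] to [b] and fix the rest. The coefficient is then
    minus the sum of the forbidden-set sizes over the fixed vertices, where [b] carries the union of
    [r a] and [r b]; inclusion-exclusion turns its size into the intersection term. *)
Lemma coef_retraction_poly1 f a b : a != b -> retraction [set [set a; b]] f ->
  (retraction_poly r f)`_n =
  (#|` r a `&` r b|)%:Z - \sum_v (#|` r v|)%:Z.
Proof.
move=> ab rf; pose g w := if w == a then b else w.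
have gK w : g (g w) = g w.
  by rewrite /g; case: (eqVneq w a) => [_|/negPf->//]; rewrite eq_sym (negPf ab).
have rg : retraction [set [set a; b]] g.
  split=> // T c; apply/forall_inP/forallP => [/(_ _ (set11 _))|cg e].
    rewrite constant_on2 => /eqP cab w.
    by rewrite /g; case: (eqVneq w a) => // ->; rewrite cab.
  move=> /set1P->; rewrite constant_on2 eq_sym.
  by have := cg a; rewrite /g eqxx.
rewrite (retraction_poly_unique r rf rg).
have mg : moved g = [set a].
  apply/setP => v; rewrite !inE /g; case: (eqVneq v a) => [->|]; last by rewrite eqxx.
  by rewrite eq_sym.
have := card_fixed g; rewrite mg cards1 add1n => -[cg].
have := @coefPn_prod_XsubC_in int V (mem (~: moved g))
  (fun v => (#|` fibre_forbidden r g v|)%:Z).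
rewrite mg cg /= => /(_ isT); rewrite /retraction_poly mg => ->.
rewrite (bigD1 b) /=; last by rewrite !inE eq_sym.
have -> : fibre_forbidden r g b = r a `|` r b.
  apply/fsetP => k; rewrite inE; apply/bigfcupP/orP.
    move=> [w /andP[_]]; rewrite /g; case: (eqVneq w a) => [->|_ /eqP->]; by [left|right].
  case=> [ka|kb]; [exists a|exists b] => //; rewrite mem_index_enum /g ?eqxx //.
  by rewrite /= (eq_sym b) (negPf ab) eqxx.
rewrite (eq_bigr (fun v => (#|` r v|)%:Z)) => [|v]; last first.
  rewrite !inE => /andP[va vb].
  rewrite /fibre_forbidden (big_pred1 v) // => w; rewrite /= /g.
  by case: (eqVneq w a) => // ->; rewrite eq_sym (negPf vb) eq_sym (negPf va).
rewrite [X in _ = _ - X](bigD1 a) //=.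
rewrite [X in _ = _ - (_ + X)](bigD1 b) /=; last by rewrite eq_sym.
have -> : \sum_(i in ~: [set a] | i != b) (#|` r i|)%:Z
        = \sum_(i | (i != a) && (i != b)) (#|` r i|)%:Z.
  by apply: eq_bigl => v; rewrite !inE.
rewrite addrA opprD [in RHS]opprD addrA -PoszD -cardfsUI PoszD.
by congr (_ - _); rewrite opprD addrCA subrr addr0.
Qed.

(** The colouring [c] merges the three vertices and separates all others, so its invariance keeps
    [f a] inside the triangle and fixes every vertex outside. Since [f a] is fixed as well, at most
    two vertices move. *)
Lemma retraction_triangle S f a b d : S = triangle_edges a b d ->
  retraction S f -> (#|moved f| <= 2)%N.
Proof.
move=> ES [fK fP]; pose c w := if w \in [:: a; b; d] then a else w.
have /forallP cf : [forall v, c (f v) == c v].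
  rewrite -fP ES; apply/forall_inP => e; rewrite !inE => /orP[/orP[]|] /eqP->;
  by rewrite constant_on2 /c !inE !eqxx ?orbT.
have aT : a \in [:: a; b; d] by rewrite mem_head.
have faT : f a \in [:: a; b; d].
  have := cf a; rewrite {2}/c aT /c; case: ifP => // fa /eqP E.
  by rewrite E aT in fa.
have sub : moved f \subset [set v in [:: a; b; d]] :\ f a.
  apply/subsetP => v; rewrite in_setD1 !in_set => fv; apply/andP; split.
    by apply: contraNneq fv => ->; rewrite fK.
  apply: contraNT fv => vT; have := cf v; rewrite /c (negPf vT).
  by case: ifP => // _ /eqP E; rewrite -E aT in vT.
apply: leq_trans (subset_leq_card sub) _.
have := card_size [:: a; b; d]; rewrite -(cardsE (mem [:: a; b; d])).
by rewrite (cardsD1 (f a)) inE faT.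
Qed.

End Coefficients.

(** Moved vertices [p] and [q] leave room for only three edges: [p] to [f p], [q] to [f q], and [p]
    to [q]. Having more than two edges, [S] contains them all; the edge from [p] to [q] gives
    [f p = f q], the third corner. *)
Lemma retraction_moved2 (V : finType) (S : {set {set V}}) (f : V -> V) :
  {in S, forall e : {set V}, #|e| = 2%N} -> retraction S f ->
  #|moved f| = 2%N -> (2 < #|S|)%N ->
  exists a b d, [/\ a != b, b != d, d != a & S = triangle_edges a b d].
Proof.
move=> S2 rf /eqP/cards2P[p [q [pq mf]]] S3.
have ES : S = [set [set p; f p]; [set q; f q]; [set p; q]].
  apply/eqP; rewrite eqEcard; apply/andP; split; last first.
    rewrite setUC cardsU1 cards2; apply: leq_trans S3.
    by case: (_ \notin _); case: (_ != _).
  apply: subset_trans (retraction_edges S2 rf) _; rewrite mf.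
  apply/subsetP => e; rewrite in_setU => /orP[/imsetP[v /set2P[]-> ->]|].
  - by rewrite !inE eqxx.
  - by rewrite !inE eqxx orbT.
  rewrite inE => /andP[se /eqP e2]; rewrite !inE.
  by rewrite [e == [set p; q]]eqEcard se e2 cards2 pq orbT.
have fpq : f p = f q by apply: retraction_edge rf _; rewrite ES !inE eqxx orbT.
have [fp fq] : f p != p /\ f q != q.
  have : p \in moved f /\ q \in moved f by rewrite mf set21 set22.
  by rewrite !inE.
exists p, q, (f p); split=> //; first by rewrite fpq eq_sym.
rewrite ES /triangle_edges -fpq (setUC [set p] [set f p]).
by apply/setP => e; rewrite !inE orbC orbA orbAC.
Qed.

(** Two edges move exactly two vertices, by the bounds from both sides. Three or more edges move at
    least two, and exactly two only for a triangle, whose sign is negative; otherwise the degree is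
    too small. *)
Lemma signed_coef_retraction_poly (V : finType) (r : restraint V) (n : nat)
    (G : sgraph V) (S : {set {set V}}) (f : V -> V) :
  #|V| = n.+2 -> S \subset edges G -> retraction S f ->
  (#|moved f| <= #|S|)%N ->
  (-1) ^+ #|S| * (retraction_poly r f)`_n =
    (if S == set0 then (retraction_poly r f)`_n else 0)
    + (if #|S| == 1%N then - (retraction_poly r f)`_n else 0)
    + (#|S| == 2%N)%:Z - (S \in snd @: triangles G)%:Z.
Proof.
move=> cV sSG rf le_f.
have S2 : {in S, forall e : {set V}, #|e| = 2%N}.
  by move=> e /(subsetP sSG); apply: edges_card2.
have tri3 : S \in snd @: triangles G -> #|S| = 3.
  by move=> /mem_triangles[_ [a [b [d [ab bd da ->]]]]]; apply: card_triangle_edges.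
have := card_retraction_edges S2 rf; rewrite -cards_eq0.
have [lt_S3|le3S] := ltnP #|S| 3.
  have -> : (S \in snd @: triangles G) = false.
    by apply/negP => /tri3 cS; rewrite cS in lt_S3.
  case cS: #|S| lt_S3 le_f => [|[|[|k]]] //= _ le_f.
  - by rewrite expr0 mul1r !addr0 ?subr0.
  - by rewrite expr1 mulN1r add0r !addr0 ?subr0.
  rewrite expr2 mulrNN !mul1r !add0r ?subr0 => ge_f.
  by rewrite coef_retraction_poly_moved2 //; case: #|moved f| le_f ge_f => [|[|[|m]]].
rewrite (gtn_eqF le3S) !gtn_eqF ?(ltn_trans _ le3S) // !add0r => ge_f.
have lt1f : (1 < #|moved f|)%N.
  by move: (leq_trans le3S ge_f); case: #|moved f| => [|[|m]].
have [triS|ntri] := boolP (S \in snd @: triangles G).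
  have /mem_triangles[_ [a [b [d [_ _ _ ES]]]]] := triS.
  rewrite (tri3 triS) coef_retraction_poly_moved2 ?mulr1 //.
  by apply/eqP; rewrite eqn_leq lt1f (retraction_triangle ES rf).
rewrite coef_retraction_poly_moved3 ?mulr0 ?subr0 // ltn_neqAle lt1f andbT eq_sym.
apply: contra ntri => /eqP f2; apply/mem_triangles; split=> //.
exact: retraction_moved2 f2 le3S.
Qed.

(** * Summing the contributions over the edge sets *)

Lemma sum_edges (n : nat) (V : finType) (u : 'I_n -> V) (G : sgraph V)
    (F : {set V} -> int) : bijective u ->
  \sum_(e in edges G) F e =
  \sum_(i < n) \sum_(j < n | (i < j)%N && adj G (u i) (u j)) F [set u i; u j].
Proof.
move=> bij_u; have u_inj := bij_inj bij_u; have [v vK uK] := bij_u.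
pose A := [set p : 'I_n * 'I_n | (p.1 < p.2)%N && adj G (u p.1) (u p.2)].
rewrite pair_big_dep /=.
have -> : edges G = [set [set u p.1; u p.2] | p in A].
  apply/setP => e; apply/idP/imsetP => [eG|[[i j]]]; last first.
    by rewrite inE => /andP[_ /= ?] ->.
  have /eqP/cards2P[a [b [ab eab]]] := edges_card2 eG.
  have : v a != v b by apply: contra ab => /eqP /(congr1 u); rewrite !uK => ->.
  (* Listing the end of smaller index first selects one ordered pair for each edge. *)
  rewrite -val_eqE neq_ltn => /orP[lt_ab|lt_ba].
    by exists (v a, v b); rewrite ?inE /= ?lt_ab /adj !uK -?eab.
  by exists (v b, v a); rewrite ?inE /= ?lt_ba /adj !uK 1?setUC -?eab // setUC.
rewrite big_imset /=; first by apply: eq_bigl => p; rewrite inE.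
move=> [i j] [k l]; rewrite !inE /= => /andP[lt_ij _] /andP[lt_kl _] E.
have : u i \in [set u k; u l] by rewrite -E set21.
have : u j \in [set u k; u l] by rewrite -E set22.
move=> /set2P[] /u_inj ej /set2P[] /u_inj ei; rewrite ?ei ?ej //.
- by rewrite ei ej ltnn in lt_ij.
- by rewrite ei ej ltnNge ltnW in lt_ij.
- by rewrite ei ej ltnn in lt_ij.
Qed.

Theorem theorem3p2 (n : nat) (V : finType) (u : 'I_n -> V) (G : sgraph V)
    (r : restraint V) (a : nat -> int)
    (hn : (2 <= n)%N)
    (hu : bijective u)
    (ha : forall x : nat, (max_forbidden r <= x)%N ->
       (restrained_count G r x)%:Z =
       \sum_(i < n.+1) (-1) ^+ (n - i)%N * a i * x%:Z ^+ i) :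
  a (n - 2)%N =
    'C(#|edges G|, 2)%:Z - #|triangles G|%:Z
    + \sum_(i < n) \sum_(j < n | (i < j)%N) (#|` r (u i)|)%:Z * (#|` r (u j)|)%:Z
    + #|edges G|%:Z * \sum_(i < n) (#|` r (u i)|)%:Z
    - \sum_(i < n) \sum_(j < n | (i < j)%N && adj G (u i) (u j))
        (#|` r (u i) `&` r (u j)|)%:Z.
Proof.
(* Writing the number of vertices as [n.+2] turns the index sought into [n]. *)
case: n hn u hu ha => [|[|n]] // _ u hu ha; rewrite !subSS subn0.
have cV : #|V| = n.+2 by rewrite -(bij_eq_card hu) card_ord.
(* One retraction is chosen for each edge set; for other [S] the identity is a mere placeholder. *)
have /fin_all_exists[f fP] (S : {set {set V}}) : exists f : V -> V,
    S \subset edges G -> retraction S f /\ (#|moved f| <= #|S|)%N.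
  have [sSG|] := boolP (S \subset edges G); last by exists id.
  have [|g gP] := @exists_retraction V S; last by exists g.
  by move=> e /(subsetP sSG); apply: edges_card2.
pose q S := (retraction_poly r (f S))`_n.
have -> : a n = \sum_(S : {set {set V}} | S \subset edges G) (-1) ^+ #|S| * q S.
  (* The given expansion and Whitney's agree at all large [x], hence as polynomials; at index [n]
     the sign on the left is [(-1) ^+ 2]. *)
  have E : \poly_(i < n.+3) ((-1) ^+ (n.+2 - i) * a i) =
      \sum_(S : {set {set V}} | S \subset edges G)
        (-1) ^+ #|S| *: retraction_poly r (f S).
    apply: (@poly_int_eventually_inj _ _ (max_forbidden r).+1) => x lt_x.
    rewrite horner_poly -ha 1?ltnW // restrained_count_expansion horner_sum.
    apply: eq_bigr => S /fP[rf _].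
    by rewrite hornerZ (card_constant_colourings rf).
  have /(congr1 (fun p : {poly int} => p`_n)) := E.
  rewrite coef_poly ltnS leqW // subSn // subSn // subnn expr2 mulrNN !mul1r => ->.
  by rewrite coef_sum; apply: eq_bigr => S _; rewrite coefZ.
under eq_bigr => S sSG.
  have [rf lef] := fP S sSG.
  rewrite (signed_coef_retraction_poly r cV sSG rf lef) -/(q S); over.
rewrite sumrB !big_split /= -big_mkcondr -big_mkcondr /=.
have -> : \sum_(S : {set {set V}} | (S \subset edges G) && (S == set0)) q S =
    \sum_(i < n.+2) \sum_(j < n.+2 | (i < j)%N)
      (#|` r (u i)|)%:Z * (#|` r (u j)|)%:Z.
  rewrite (big_pred1 set0) => [|S]; last first.
    by rewrite /= andbC; case: (eqVneq S set0) => //= ->; rewrite sub0set.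
  by have [rf _] := fP set0 (sub0set _); apply: coef_retraction_poly0.
have -> : \sum_(S : {set {set V}} | (S \subset edges G) && (#|S| == 1%N)) - q S =
    #|edges G|%:Z * \sum_(i < n.+2) (#|` r (u i)|)%:Z
    - \sum_(i < n.+2) \sum_(j < n.+2 | (i < j)%N && adj G (u i) (u j))
        (#|` r (u i) `&` r (u j)|)%:Z.
  transitivity (\sum_(e in edges G) - q [set e]).
    rewrite -(big_imset (h := set1) (fun S => - q S)) => [|? ? _ _ /set1_inj//].
    apply: eq_bigl => S; apply/andP/imsetP => [[+ /cards1P[e ES]]|[e eG ->]].
      by rewrite ES sub1set => eG; exists e.
    by rewrite sub1set cards1.
  (* By the single-edge formula the inner bracket is the size of the intersection of the restraints
     at the two ends of [e]. *)
  transitivity (\sum_(e in edges G) (\sum_v (#|` r v|)%:Z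
      - (\sum_v (#|` r v|)%:Z + q [set e]))).
    by apply: eq_bigr => e _; rewrite opprD addrA subrr add0r.
  rewrite sumrB sumr_const -mulr_natl natz.
  congr (_ * _ - _).
    by rewrite (reindex u) //; apply: onW_bij.
  rewrite (sum_edges _ _ hu); apply: eq_bigr => i _.
  apply: eq_bigr => j /andP[lt_ij ad].
  have [|rf _] := fP [set [set u i; u j]]; first by rewrite sub1set.
  rewrite /q (coef_retraction_poly1 r cV _ rf) 1?addrC ?subrK //.
  by rewrite (inj_eq (bij_inj hu)) -val_eqE neq_ltn lt_ij.
have -> : \sum_(S : {set {set V}} | S \subset edges G) (#|S| == 2%N)%:Z =
    'C(#|edges G|, 2)%:Z.
  rewrite -cards_draws -sum1_card (big_morph Posz PoszD (erefl _)).
  rewrite [LHS]big_mkcond [RHS]big_mkcond; apply: eq_bigr => S _; rewrite inE.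
  by case: (_ \subset _); case: eqP.
have -> : \sum_(S : {set {set V}} | S \subset edges G)
    (S \in snd @: triangles G)%:Z = #|triangles G|%:Z.
  rewrite card_triangles -sum1_card (big_morph Posz PoszD (erefl _)).
  rewrite [LHS]big_mkcond [RHS]big_mkcond; apply: eq_bigr => S _.
  have [sSG|] := boolP (S \subset edges G); first by case: (_ \in _).
  by case: ifP => // /mem_triangles[->].
by rewrite -[LHS]addrA [LHS]addrC !addrA.
Qed.
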